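(* Let $e\colon p=q$ be a semigroup equation without parameters, where $p,q$ are nonempty words in variables, and let $x_1,\dots,x_n$ be the distinct variables occurring in $pq$. Then $e$ is universal if and only if either (i) $|p|_{x_i}=|q|_{x_i}$ for all $i=1,2,\dots,n$; or (ii) there exist $x,y\in\{x_1,\dots,x_n\}$ such that $|p|_x<|q|_x$ and $|p|_y>|q|_y$.
   Context: For a word $w$ and a letter $y$, $|w|_y$ denotes the number of occurrences of $y$ in $w$. An equation without parameters is one in which all letters are existentially quantified variables, i.e. it is the sentence $(\exists x_1,\dots,x_n)\colon p=q$. It is universal (semigroup universal) if it is solvable in every (nonempty) semigroup $S$, i.e. for every semigroup $S$ there is an assignment of elements of $S$ to $x_1,\dots,x_n$ under which $p$ and $q$ take the same value. *)

(* Defs.v *)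
From mathcomp Require Import all_boot.

Set Implicit Arguments.
Unset Strict Implicit.
Unset Printing Implicit Defensive.

(* The variables x_1, ..., x_n are the elements of 'I_n and words are         *)
(* sequences over 'I_n.  A semigroup is a type S with op : SemiGroup.law S    *)
(* rather than a semigroupType, which would force a choiceType on S.          *)

(* The empty word has no value in a semigroup, hence the option type. *)
Definition word_value (S : Type) (op : SemiGroup.law S) (n : nat)
    (a : 'I_n -> S) (w : seq 'I_n) : option S :=
  if w is x :: s then Some (foldl (fun v y => op v (a y)) (a x) s) else None.

Definition solvable_in (S : Type) (op : SemiGroup.law S) (n : nat)
    (p q : seq 'I_n) : Prop :=
  exists a : 'I_n -> S, word_value op a p = word_value op a q.

Definition semigroup_universal (n : nat) (p q : seq 'I_n) : Prop :=
  forall (S : Type) (op : SemiGroup.law S), inhabited S -> solvable_in op p q.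

(* Main.v *)
Require Import Defs.
From HB Require Import structures.
From mathcomp Require Import all_boot.

(** The statement reduces to linear algebra over the positive integers: the
    equation [p = q] is universal if and only if there are weights [k x > 0]
    giving [p] and [q] the same total weight.

    Such weights solve the equation in every semigroup, because sending each
    [x] to [c ^ (k x)], for any fixed element [c], turns a word into the power
    of [c] given by its total weight ([solvable_of_weights]).  Conversely, a
    solution in the additive semigroup of positive integers is such a system of
    weights ([weights_of_universal]).

    When do such weights exist?  If every variable occurs at most as often in
    one word as in the other, equality of the total weights forces equality of
    all the counts ([eq_count_of_weights]); this excludes everything except (i)
    and (ii).  In case (i) the words have equal length and all weights can be 1.
    In case (ii) the shorter word still contains some variable more often than
    the longer one does, and making that variable heavier compensates for the
    difference in length ([weights_of_excess]). *)

Set Implicit Arguments.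
Unset Strict Implicit.
Unset Printing Implicit Defensive.

Definition balancing_weights n (p q : seq 'I_n) (k : 'I_n -> nat) : Prop :=
  (forall x, 0 < k x) /\ \sum_(x <- p) k x = \sum_(x <- q) k x.

Section Powers.

Variables (S : Type) (op : SemiGroup.law S).

(** Only the exponents [m > 0] are meaningful; the value at 0 is [c], as a
    semigroup need not have a unit. *)
Definition sgpow (c : S) (m : nat) : S := iter m.-1 (op c) c.

Lemma sgpowD c i j : 0 < i -> 0 < j -> sgpow c (i + j) = op (sgpow c i) (sgpow c j).
Proof.
case: i => // i _; case: j => // j _; rewrite /sgpow addSn addnS /=.
elim: i => [|i IHi] //=.
by rewrite -SemiGroup.opA -IHi.
Qed.

Lemma foldl_sgpow n c (k : 'I_n -> nat) (s : seq 'I_n) m :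
    (forall x, 0 < k x) -> 0 < m ->
  foldl (fun v y => op v (sgpow c (k y))) (sgpow c m) s =
  sgpow c (m + \sum_(x <- s) k x).
Proof.
move=> k_gt0; elim: s m => [|y s IHs] m m_gt0 /=; first by rewrite big_nil addn0.
by rewrite -sgpowD // IHs ?addn_gt0 ?m_gt0 // big_cons addnA.
Qed.

Lemma word_value_sgpow n c (k : 'I_n -> nat) (w : seq 'I_n) :
    (forall x, 0 < k x) -> w != [::] ->
  word_value op (fun x => sgpow c (k x)) w = Some (sgpow c (\sum_(x <- w) k x)).
Proof. by case: w => // x s k_gt0 _; rewrite /= foldl_sgpow // big_cons. Qed.

Lemma solvable_of_weights n (p q : seq 'I_n) (k : 'I_n -> nat) :
    p != [::] -> q != [::] -> inhabited S ->
  balancing_weights p q k -> solvable_in op p q.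
Proof.
move=> p_neq0 q_neq0 [c] [k_gt0 eq_k]; exists (fun x => sgpow c (k x)).
by rewrite !word_value_sgpow // eq_k.
Qed.

End Powers.

(** The additive semigroup of positive integers, with [m : nat] standing for
    the integer [m + 1]. *)
Definition addS (i j : nat) : nat := (i + j).+1.

Lemma addSA : associative addS.
Proof. by move=> i j l; rewrite /addS addnS addSn addnA. Qed.

HB.instance Definition _ := SemiGroup.isLaw.Build nat addS addSA.

Lemma foldl_addS n (a : 'I_n -> nat) (s : seq 'I_n) m :
  (foldl (fun v y => addS v (a y)) m s).+1 = m.+1 + \sum_(x <- s) (a x).+1.
Proof.
elim: s m => [|y s IHs] m /=; first by rewrite big_nil addn0.
by rewrite IHs big_cons /addS addnA addSn addnS.
Qed.

Lemma weights_of_universal n (p q : seq 'I_n) :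
    p != [::] -> q != [::] -> semigroup_universal p q ->
  exists k, balancing_weights p q k.
Proof.
move=> p_neq0 q_neq0 /(_ nat addS (inhabits 0)) [a].
case: p p_neq0 => // x s _; case: q q_neq0 => // y t _ [/(congr1 succn)].
rewrite !foldl_addS => eq_a; exists (fun x => (a x).+1); split=> //.
by rewrite !big_cons.
Qed.

Lemma sum_seq_count n (k : 'I_n -> nat) (w : seq 'I_n) :
  \sum_(x <- w) k x = \sum_x count_mem x w * k x.
Proof.
elim: w => [|y w IHw]; first by rewrite big_nil big1.
rewrite big_cons IHw (bigD1 y) //= [RHS](bigD1 y) //= eqxx mulnDl mul1n addnA.
by congr (_ + _); apply: eq_bigr => x /negbTE x_neq_y; rewrite eq_sym x_neq_y.
Qed.

(** A sum of nonnegative terms [(count_mem x q - count_mem x p) * k x] vanishes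
    only if every term does. *)
Lemma eq_count_of_weights n (p q : seq 'I_n) (k : 'I_n -> nat) :
    balancing_weights p q k -> (forall x, count_mem x p <= count_mem x q) ->
  forall x, count_mem x p = count_mem x q.
Proof.
move=> [k_gt0 eq_k] le_pq x.
have le_terms i : true ->
    count_mem i p * k i <= count_mem i q * k i ?= iff (count_mem i p == count_mem i q).
  by move=> _; split; rewrite ?leq_pmul2r // eqn_pmul2r.
have [_] := leqif_sum le_terms.
by rewrite -!sum_seq_count eq_k eqxx => /esym/forallP/(_ x)/eqP.
Qed.

Lemma balancing_weights_sym n (p q : seq 'I_n) k :
  balancing_weights p q k -> balancing_weights q p k.
Proof. by case=> k_gt0 eq_k; split. Qed.

Lemma weights_of_eq_count n (p q : seq 'I_n) :
    (forall x, count_mem x p = count_mem x q) ->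
  exists k, balancing_weights p q k.
Proof.
move=> eq_pq; exists (fun=> 1); split=> //.
by rewrite (sum_seq_count _ p) (sum_seq_count _ q); apply: eq_bigr => x _; rewrite eq_pq.
Qed.

(** With [v] the excess of [y] in [p], the uniform weight [v] leaves [p] lighter
    by [v * (size q - size p)], and each extra unit of weight on [y] recovers
    [v]; so [y] needs [size q - size p] extra units. *)
Lemma weights_of_excess n (p q : seq 'I_n) (y : 'I_n) :
    size p <= size q -> count_mem y q < count_mem y p ->
  exists k, balancing_weights p q k.
Proof.
move=> le_size lt_y.
pose v := count_mem y p - count_mem y q; pose d := size q - size p.
have total w : \sum_(x <- w) (v + (x == y) * d) = size w * v + count_mem y w * d.
  elim: w => [|x w IHw]; first by rewrite big_nil.
  by rewrite big_cons IHw /= mulSn mulnDl addnACA.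
exists (fun x => v + (x == y) * d); split.
  by move=> x; rewrite addn_gt0 subn_gt0 lt_y.
rewrite !total -(subnK le_size) -(subnK (ltnW lt_y)) -/v -/d !mulnDl.
by rewrite (mulnC v) addnCA addnA.
Qed.

Theorem corollary6p7 (n : nat) (p q : seq 'I_n)
    (p_nonempty : p != [::]) (q_nonempty : q != [::])
    (all_occur : forall x : 'I_n, x \in p ++ q) :
  semigroup_universal p q <->
  (forall x : 'I_n, count_mem x p = count_mem x q) \/
  (exists x y : 'I_n, count_mem x p < count_mem x q /\
                      count_mem y p > count_mem y q).
Proof.
split=> [/(weights_of_universal p_nonempty q_nonempty) [k bal_k] | counts].
  have [/existsP [x lt_x] | /existsPn le_qp] :=
    boolP [exists x, count_mem x p < count_mem x q]; last first.
    left=> x; apply/esym/(eq_count_of_weights (balancing_weights_sym bal_k)) => z.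
    by rewrite leqNgt le_qp.
  have [/existsP [y lt_y] | /existsPn le_pq] :=
    boolP [exists y, count_mem y q < count_mem y p]; last first.
    by left; apply: (eq_count_of_weights bal_k) => z; rewrite leqNgt le_pq.
  by right; exists x, y.
suff [k bal_k] : exists k, balancing_weights p q k.
  by move=> S op inhS; apply: solvable_of_weights bal_k.
case: counts => [/weights_of_eq_count // | [x [y [lt_x lt_y]]]].
have [le_size | /ltnW le_size] := leqP (size p) (size q).
  exact: weights_of_excess lt_y.
have [k /balancing_weights_sym bal_k] := weights_of_excess le_size lt_x.
by exists k.
Qed.
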